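(* Let $(A,\cdot,\{~,~,~\},\{\!\{~,~,~\}\!\})$ be an associative-Yamaguti algebra and $(A[[t]],\mu_t,F_t,G_t)$ a formal deformation of it, with $\mu_t(a,b)=a\cdot b+t\mu_1(a,b)+\cdots$, $F_t(a,b,c)=\{a,b,c\}+tF_1(a,b,c)+\cdots$, $G_t(a,b,c)=\{\!\{a,b,c\}\!\}+tG_1(a,b,c)+\cdots$. Then $(\mu_1,F_1,G_1)$ is a $(2,3)$-cocycle of the associative-Yamaguti algebra $(A,\cdot,\{~,~,~\},\{\!\{~,~,~\}\!\})$ with coefficients in the adjoint representation.
   Context: All vector spaces, linear maps and tensor products are over a field $\mathbf{k}$ of characteristic $0$ unless indicated. An associative-Yamaguti algebra is a quadruple $(A,\cdot,\{~,~,~\},\{\!\{~,~,~\}\!\})$ consisting of a vector space $A$ with linear operations $\cdot:A\otimes A\to A$ and $\{~,~,~\},\{\!\{~,~,~\}\!\}:A\otimes A\otimes A\to A$ such that for all $a,b,c,d,e\in A$: (AY1) $(a\cdot b)\cdot c-a\cdot(b\cdot c)+\{a,b,c\}-\{\!\{a,b,c\}\!\}=0$; (AY2) $\{a\cdot b,c,d\}=\{a,b\cdot c,d\}$; (AY3) $\{a,b,c\cdot d\}=\{a,b,c\}\cdot d$; (AY4) $\{\!\{a\cdot b,c,d\}\!\}=a\cdot\{\!\{b,c,d\}\!\}$; (AY5) $\{\!\{a,b\cdot c,d\}\!\}=\{\!\{a,b,c\cdot d\}\!\}$; (AY6) $a\cdot\{b,c,d\}=\{\!\{a,b,c\}\!\}\cdot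 d$; (AY7) $\{\{a,b,c\},d,e\}=\{a,\{\!\{b,c,d\}\!\},e\}=\{a,b,\{c,d,e\}\}$; (AY8) $\{a,\{b,c,d\},e\}=\{\{\!\{a,b,c\}\!\},d,e\}$; (AY9) $\{\!\{\{\!\{a,b,c\}\!\},d,e\}\!\}=\{\!\{a,\{b,c,d\},e\}\!\}=\{\!\{a,b,\{\!\{c,d,e\}\!\}\}\!\}$; (AY10) $\{\!\{a,\{\!\{b,c,d\}\!\},e\}\!\}=\{\!\{a,b,\{c,d,e\}\}\!\}$; (AY11) $\{a,b,\{\!\{c,d,e\}\!\}\}=\{\!\{\{a,b,c\},d,e\}\!\}$. An associative-Yamaguti algebra over $\mathbf{k}[[t]]$ is defined in the same way with $\mathbf{k}[[t]]$-modules and $\mathbf{k}[[t]]$-linear operations. Let $A[[t]]$ be the $\mathbf{k}[[t]]$-module of formal power series in $t$ with coefficients in $A$. A formal ($1$-parameter) deformation of $A$ consists of $\mathbf{k}[[t]]$-multilinear operations $\mu_t$ (binary), $F_t,G_t$ (ternary) on $A[[t]]$ of the form, for elements $a,b,c\in A$, $\mu_t(a,b)=a\cdot b+\sum_{i\ge1}t^i\mu_i(a,b)$, $F_t(a,b,c)=\{a,b,c\}+\sum_{i\ge1}t^iF_i(a,b,c)$, $G_t(a,b,c)=\{\!\{a,b,c\}\!\}+\sum_{i\ge1}t^iG_i(a,b,c)$, with linear maps $\mu_i:A^{\otimes2}\to A$, $F_i,G_i:A^{\otimes3}\to A$, such that $(A[[t]],\mu_t,F_t,G_t)$ is an associative-Yamaguti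 algebra over $\mathbf{k}[[t]]$. The adjoint representation of $A$ is the vector space $A$ itself with actions given by the structure operations of $A$. A $(2,3)$-cocycle of $A$ with coefficients in the adjoint representation is a triple $(\mu,F,G)$ of linear maps $\mu:A^{\otimes2}\to A$, $F,G:A^{\otimes3}\to A$ such that for all $a,b,c,d,e\in A$: (1) $\mu(a,b)\cdot c+\mu(a\cdot b,c)-a\cdot\mu(b,c)-\mu(a,b\cdot c)+F(a,b,c)-G(a,b,c)=0$; (2) $\{\mu(a,b),c,d\}+F(a\cdot b,c,d)=\{a,\mu(b,c),d\}+F(a,b\cdot c,d)$; (3) $\{a,b,\mu(c,d)\}+F(a,b,c\cdot d)=\mu(\{a,b,c\},d)+F(a,b,c)\cdot d$; (4) $\{\!\{\mu(a,b),c,d\}\!\}+G(a\cdot b,c,d)=\mu(a,\{\!\{b,c,d\}\!\})+a\cdot G(b,c,d)$; (5) $\{\!\{a,\mu(b,c),d\}\!\}+G(a,b\cdot c,d)=\{\!\{a,b,\mu(c,d)\}\!\}+G(a,b,c\cdot d)$; (6) $\mu(a,\{b,c,d\})+a\cdot F(b,c,d)=\mu(\{\!\{a,b,c\}\!\},d)+G(a,b,c)\cdot d$; (7) $\{F(a,b,c),d,e\}+F(\{a,b,c\},d,e)=\{a,G(b,c,d),e\}+F(a,\{\!\{b,c,d\}\!\},e)=\{a,b,F(c,d,e)\}+F(a,b,\{c,d,e\})$; (8) $\{a,F(b,c,d),e\}+F(a,\{b,c,d\},e)=\{G(a,b,c),d,e\}+F(\{\!\{a,b,c\}\!\},d,e)$;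 (9) $\{\!\{G(a,b,c),d,e\}\!\}+G(\{\!\{a,b,c\}\!\},d,e)=\{\!\{a,F(b,c,d),e\}\!\}+G(a,\{b,c,d\},e)=\{\!\{a,b,G(c,d,e)\}\!\}+G(a,b,\{\!\{c,d,e\}\!\})$; (10) $\{\!\{a,G(b,c,d),e\}\!\}+G(a,\{\!\{b,c,d\}\!\},e)=\{\!\{a,b,F(c,d,e)\}\!\}+G(a,b,\{c,d,e\})$; (11) $\{a,b,G(c,d,e)\}+F(a,b,\{\!\{c,d,e\}\!\})=\{\!\{F(a,b,c),d,e\}\!\}+G(\{a,b,c\},d,e)$. *)

(* Defs.v *)
From HB Require Import structures.
From mathcomp Require Import all_boot all_order all_algebra.
From mathcomp Require Import boolp.

Set Implicit Arguments.
Unset Strict Implicit.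
Unset Printing Implicit Defensive.

Import GRing.Theory.
Local Open Scope ring_scope.

(* [fps V] is V[[t]], a series being identified with its sequence of
   coefficients.  It is wrapped in a record so that its ring structure (Cauchy
   product) cannot be confused with a pointwise structure on functions.  For a
   k-module V it is a module over the ring [fps k]. *)

Record fps (V : Type) := FPS { fps_coef : nat -> V }.

HB.instance Definition _ (V : Type) := gen_eqMixin (fps V).
HB.instance Definition _ (V : Type) := gen_choiceMixin (fps V).

Lemma fpsP (V : Type) (x y : fps V) :
  (forall n, fps_coef x n = fps_coef y n) -> x = y.
Proof. by case: x => x; case: y => y /= /funext ->. Qed.

Section FpsZmodule.
Variable V : zmodType.

Definition fps_const (a : V) : fps V := FPS (fun n => if n == 0%N then a else 0).
Definition fps_add (x y : fps V) : fps V :=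
  FPS (fun n => fps_coef x n + fps_coef y n).
Definition fps_opp (x : fps V) : fps V := FPS (fun n => - fps_coef x n).
Definition fps_zero : fps V := FPS (fun=> 0).

Fact fps_addA : associative fps_add.
Proof. by move=> x y z; apply: fpsP => n /=; rewrite addrA. Qed.
Fact fps_addC : commutative fps_add.
Proof. by move=> x y; apply: fpsP => n /=; rewrite addrC. Qed.
Fact fps_add0 : left_id fps_zero fps_add.
Proof. by move=> x; apply: fpsP => n /=; rewrite add0r. Qed.
Fact fps_addN : left_inverse fps_zero fps_opp fps_add.
Proof. by move=> x; apply: fpsP => n /=; rewrite addNr. Qed.

HB.instance Definition _ :=
  GRing.isZmodule.Build (fps V) fps_addA fps_addC fps_add0 fps_addN.

End FpsZmodule.

Section FpsProducts.
Variables (k : comNzRingType) (V : lmodType k).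
Implicit Types (f g : fps k) (x y : fps V).

Definition fps_mul f g : fps k :=
  FPS (fun n => \sum_(i < n.+1) fps_coef f i * fps_coef g (n - i)).

Definition fps_scale f x : fps V :=
  FPS (fun n => \sum_(i < n.+1) fps_coef f i *: fps_coef x (n - i)).

Fact fps_scaleA f g x : fps_scale f (fps_scale g x) = fps_scale (fps_mul f g) x.
Proof.
apply: fpsP => n /=.
pose h j m := (fps_coef f j * fps_coef g (m - j)) *: fps_coef x (n - m).
transitivity (\sum_(j < n.+1) \sum_(m < n.+1 | (j <= m)%N) h j m).
  apply: eq_bigr => j _; rewrite scaler_sumr.
  rewrite -[RHS](big_geq_mkord j n.+1 xpredT (h j)).
  rewrite -[X in index_iota X _]add0n big_addn.
  rewrite subSn ?leq_ord // big_mkord; apply: eq_bigr => i _.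
  by rewrite /h addnK scalerA addnC subnDA.
rewrite (exchange_big_dep xpredT) //=; apply: eq_bigr => m _.
rewrite scaler_suml (big_ord_widen _ (h^~ m) (ltn_ord m)).
by apply: eq_bigl => j; rewrite ltnS.
Qed.

Fact fps_scale1 x : fps_scale (fps_const 1) x = x.
Proof.
apply: fpsP => n /=; rewrite big_ord_recl /= scale1r subn0 big1 ?addr0 // => i _.
by rewrite scale0r.
Qed.

Fact fps_scaleDr : right_distributive fps_scale (@fps_add V).
Proof.
move=> f x y; apply: fpsP => n /=; rewrite -big_split /=.
by apply: eq_bigr => i _; rewrite scalerDr.
Qed.

Fact fps_scaleDl x : {morph fps_scale^~ x : f g / fps_add f g >-> fps_add f g}.
Proof.
move=> f g; apply: fpsP => n /=; rewrite -big_split /=.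
by apply: eq_bigr => i _; rewrite scalerDl.
Qed.

End FpsProducts.

Section FpsRing.
Variable k : comNzRingType.

Fact fps_mulC : commutative (@fps_mul k).
Proof.
move=> f g; apply: fpsP => n /=; rewrite (reindex_inj rev_ord_inj) /=.
by apply: eq_bigr => i _; rewrite mulrC subSS subKn // -ltnS.
Qed.
Fact fps_mulA : associative (@fps_mul k).
Proof. exact: (@fps_scaleA k k^o). Qed.
Fact fps_mul1 : left_id (fps_const 1) (@fps_mul k).
Proof. exact: (@fps_scale1 k k^o). Qed.
Fact fps_mulDl : left_distributive (@fps_mul k) (@fps_add k).
Proof. by move=> f g h; exact: (@fps_scaleDl k k^o). Qed.
Fact fps_one_neq0 : fps_const 1 != 0 :> fps k.
Proof.
apply/eqP => /(congr1 (fun f : fps k => fps_coef f 0)) /= /eqP.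
by rewrite oner_eq0.
Qed.

HB.instance Definition _ := GRing.Zmodule_isComNzRing.Build (fps k)
  fps_mulA fps_mulC fps_mul1 fps_mulDl fps_one_neq0.

End FpsRing.

HB.instance Definition _ (k : comNzRingType) (V : lmodType k) :=
  GRing.Zmodule_isLmodule.Build (fps k) (fps V)
    (@fps_scaleA k V) (@fps_scale1 k V) (@fps_scaleDr k V) (@fps_scaleDl k V).

Section Multilinear.
Variables (R : comNzRingType) (M : lmodType R).

Definition bilinear_op (m : M -> M -> M) : Prop :=
  (forall b, linear (m^~ b)) /\ (forall a, linear (m a)).

Definition trilinear_op (f : M -> M -> M -> M) : Prop :=
  [/\ forall b c, linear (fun a => f a b c),
      forall a c, linear (fun b => f a b c)
    & forall a b, linear (f a b)].

End Multilinear.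

(* [mul], [br] and [dbr] are the operations written a . b, {a, b, c} and
   {{a, b, c}}.  The ground ring is arbitrary so that the definition applies to
   both k and k[[t]]. *)

Record assoc_yamaguti (R : comNzRingType) (M : lmodType R)
    (mul : M -> M -> M) (br dbr : M -> M -> M -> M) : Prop := AssocYamaguti {
  ay_mul_bilinear : bilinear_op mul;
  ay_br_trilinear : trilinear_op br;
  ay_dbr_trilinear : trilinear_op dbr;
  ay1 : forall a b c,
    mul (mul a b) c - mul a (mul b c) + br a b c - dbr a b c = 0;
  ay2 : forall a b c d, br (mul a b) c d = br a (mul b c) d;
  ay3 : forall a b c d, br a b (mul c d) = mul (br a b c) d;
  ay4 : forall a b c d, dbr (mul a b) c d = mul a (dbr b c d);
  ay5 : forall a b c d, dbr a (mul b c) d = dbr a b (mul c d);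
  ay6 : forall a b c d, mul a (br b c d) = mul (dbr a b c) d;
  ay7 : forall a b c d e,
    br (br a b c) d e = br a (dbr b c d) e /\
    br a (dbr b c d) e = br a b (br c d e);
  ay8 : forall a b c d e, br a (br b c d) e = br (dbr a b c) d e;
  ay9 : forall a b c d e,
    dbr (dbr a b c) d e = dbr a (br b c d) e /\
    dbr a (br b c d) e = dbr a b (dbr c d e);
  ay10 : forall a b c d e, dbr a (dbr b c d) e = dbr a b (br c d e);
  ay11 : forall a b c d e, br a b (dbr c d e) = dbr (br a b c) d e
}.

Record adjoint_cocycle23 (R : comNzRingType) (A : lmodType R)
    (mul : A -> A -> A) (br dbr : A -> A -> A -> A)
    (mu : A -> A -> A) (F G : A -> A -> A -> A) : Prop := AdjointCocycle23 {
  coc_mu_bilinear : bilinear_op mu;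
  coc_F_trilinear : trilinear_op F;
  coc_G_trilinear : trilinear_op G;
  coc1 : forall a b c,
    mul (mu a b) c + mu (mul a b) c - mul a (mu b c) - mu a (mul b c)
    + F a b c - G a b c = 0;
  coc2 : forall a b c d,
    br (mu a b) c d + F (mul a b) c d = br a (mu b c) d + F a (mul b c) d;
  coc3 : forall a b c d,
    br a b (mu c d) + F a b (mul c d) = mu (br a b c) d + mul (F a b c) d;
  coc4 : forall a b c d,
    dbr (mu a b) c d + G (mul a b) c d = mu a (dbr b c d) + mul a (G b c d);
  coc5 : forall a b c d,
    dbr a (mu b c) d + G a (mul b c) d = dbr a b (mu c d) + G a b (mul c d);
  coc6 : forall a b c d,
    mu a (br b c d) + mul a (F b c d) = mu (dbr a b c) d + mul (G a b c) d;
  coc7 : forall a b c d e,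
    br (F a b c) d e + F (br a b c) d e = br a (G b c d) e + F a (dbr b c d) e /\
    br a (G b c d) e + F a (dbr b c d) e = br a b (F c d e) + F a b (br c d e);
  coc8 : forall a b c d e,
    br a (F b c d) e + F a (br b c d) e = br (G a b c) d e + F (dbr a b c) d e;
  coc9 : forall a b c d e,
    dbr (G a b c) d e + G (dbr a b c) d e
      = dbr a (F b c d) e + G a (br b c d) e /\
    dbr a (F b c d) e + G a (br b c d) e
      = dbr a b (G c d e) + G a b (dbr c d e);
  coc10 : forall a b c d e,
    dbr a (G b c d) e + G a (dbr b c d) e = dbr a b (F c d e) + G a b (br c d e);
  coc11 : forall a b c d e,
    br a b (G c d e) + F a b (dbr c d e) = dbr (F a b c) d e + G (br a b c) d e
}.

(* The families [mu], [F], [G] are the coefficients of the operations [mut],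
   [Ft], [Gt] on A[[t]]; their terms of index 0 are the operations of A, and
   the sum of the t^i mu_i(a, b) is the series with coefficients mu_i(a, b).
   The values of [mut], [Ft], [Gt] are only prescribed on constant series:
   k[[t]]-multilinearity, which is part of [assoc_yamaguti] over [fps k],
   determines the others. *)

Record formal_deformation (k : comNzRingType) (A : lmodType k)
    (mul : A -> A -> A) (br dbr : A -> A -> A -> A)
    (mut : fps A -> fps A -> fps A) (Ft Gt : fps A -> fps A -> fps A -> fps A)
    (mu : nat -> A -> A -> A) (F G : nat -> A -> A -> A -> A) : Prop :=
  FormalDeformation {
  def_mu_bilinear : forall i, bilinear_op (mu i);
  def_F_trilinear : forall i, trilinear_op (F i);
  def_G_trilinear : forall i, trilinear_op (G i);
  def_mu0 : forall a b, mu 0%N a b = mul a b;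
  def_F0 : forall a b c, F 0%N a b c = br a b c;
  def_G0 : forall a b c, G 0%N a b c = dbr a b c;
  def_mut : forall a b,
    mut (fps_const a) (fps_const b) = FPS (fun i => mu i a b);
  def_Ft : forall a b c,
    Ft (fps_const a) (fps_const b) (fps_const c) = FPS (fun i => F i a b c);
  def_Gt : forall a b c,
    Gt (fps_const a) (fps_const b) (fps_const c) = FPS (fun i => G i a b c);
  def_ay : @assoc_yamaguti (fps k) (fps A) mut Ft Gt
}.

(* Main.v *)
Require Import Defs.
From mathcomp Require Import all_boot all_order all_algebra.
Local Open Scope ring_scope.
Import GRing.Theory.

(** The cocycle identities are the coefficients of [t] in the axioms of the
    deformed algebra evaluated on constant series.  An inner operation produces
    a nonconstant series [x]; writing [x = x_0 + t y], the [k[[t]]]-linearity of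
    the outer operation [L] shows that the coefficient of [t] in [L x] only
    involves [x_0] and [x_1]. *)

Definition fps_t (k : comNzRingType) : fps k :=
  FPS (fun n => if n == 1%N then 1 else 0).

Definition fps_shift {V : Type} (x : fps V) : fps V :=
  FPS (fun n => fps_coef x n.+1).

Lemma fps_coefD {V : zmodType} (x y : fps V) n :
  fps_coef (x + y) n = fps_coef x n + fps_coef y n.
Proof. by []. Qed.

Lemma coef0_fps_tZ {k : comNzRingType} {V : lmodType k} (x : fps V) :
  fps_coef (fps_t k *: x) 0 = 0.
Proof. by rewrite /= big_ord1 scale0r. Qed.

Lemma coefS_fps_tZ {k : comNzRingType} {V : lmodType k} (x : fps V) n :
  fps_coef (fps_t k *: x) n.+1 = fps_coef x n.
Proof.
rewrite /= !big_ord_recl /= scale0r add0r scale1r /bump /= subn1 /=.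
by rewrite big1 ?addr0 // => i _; rewrite scale0r.
Qed.

(** The multiple of [t] comes first to match the shape [a *: u + v] in [linear], so that linearity
    of an operation rewrites its value directly. *)
Lemma fps_decomp {k : comNzRingType} {V : lmodType k} (x : fps V) :
  x = fps_t k *: fps_shift x + fps_const (fps_coef x 0).
Proof.
apply: fpsP => -[|n]; rewrite fps_coefD;
  by rewrite ?coef0_fps_tZ ?coefS_fps_tZ ?add0r ?addr0.
Qed.

(** Linearity sends multiples of [t] to multiples of [t], which have no constant term. *)
Lemma coef0_linear {k : comNzRingType} {V W : lmodType k} (L : fps V -> fps W)
    (x : fps V) :
  linear L -> fps_coef (L x) 0 = fps_coef (L (fps_const (fps_coef x 0))) 0.
Proof.
move=> linL; rewrite {1}[x]fps_decomp linL.
by rewrite fps_coefD coef0_fps_tZ add0r.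
Qed.

(** The first summand comes from [t *: L y] with [y] the shift of [x]: its coefficient of [t] is the
    constant term of [L y], and [coef0_linear] reduces [y] to its own constant term, the coefficient
    of [t] in [x]. *)
Lemma coef1_linear {k : comNzRingType} {V W : lmodType k} (L : fps V -> fps W)
    (x : fps V) :
  linear L ->
  fps_coef (L x) 1 = fps_coef (L (fps_const (fps_coef x 1))) 0
                   + fps_coef (L (fps_const (fps_coef x 0))) 1.
Proof.
move=> linL; rewrite {1}[x]fps_decomp linL.
by rewrite fps_coefD coefS_fps_tZ (coef0_linear _ _ linL).
Qed.

Theorem theorem5p1 (k : fieldType) (k_char0 : [pchar k] =i pred0)
    (A : lmodType k)
    (mul : A -> A -> A) (br dbr : A -> A -> A -> A)
    (mut : fps A -> fps A -> fps A) (Ft Gt : fps A -> fps A -> fps A -> fps A)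
    (mu : nat -> A -> A -> A) (F G : nat -> A -> A -> A -> A) :
  assoc_yamaguti mul br dbr ->
  formal_deformation mul br dbr mut Ft Gt mu F G ->
  adjoint_cocycle23 mul br dbr (mu 1%N) (F 1%N) (G 1%N).
Proof.
move=> _ [mu_bil F_tril G_tril mu0 F0 G0 mutE FtE GtE ayt].
have [mutl mutr] := ay_mul_bilinear ayt.
have [Ft1 Ft2 Ft3] := ay_br_trilinear ayt.
have [Gt1 Gt2 Gt3] := ay_dbr_trilinear ayt.
pose c := @fps_const A.
(* With all other arguments constant, [coef1_linear] leaves only values on constant series, which
   the deformation prescribes. One such rule is needed for each slot of each operation. *)
have mutEl f b :
    fps_coef (mut (FPS f) (c b)) 1 = mul (f 1%N) b + mu 1%N (f 0%N) b.
  by rewrite (coef1_linear _ _ (mutl _)) !mutE /= mu0.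
have mutEr a f :
    fps_coef (mut (c a) (FPS f)) 1 = mul a (f 1%N) + mu 1%N a (f 0%N).
  by rewrite (coef1_linear _ _ (mutr _)) !mutE /= mu0.
have FtE1 f b d :
    fps_coef (Ft (FPS f) (c b) (c d)) 1 = br (f 1%N) b d + F 1%N (f 0%N) b d.
  by rewrite (coef1_linear _ _ (Ft1 _ _)) !FtE /= F0.
have FtE2 a f d :
    fps_coef (Ft (c a) (FPS f) (c d)) 1 = br a (f 1%N) d + F 1%N a (f 0%N) d.
  by rewrite (coef1_linear _ _ (Ft2 _ _)) !FtE /= F0.
have FtE3 a b f :
    fps_coef (Ft (c a) (c b) (FPS f)) 1 = br a b (f 1%N) + F 1%N a b (f 0%N).
  by rewrite (coef1_linear _ _ (Ft3 _ _)) !FtE /= F0.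
have GtE1 f b d :
    fps_coef (Gt (FPS f) (c b) (c d)) 1 = dbr (f 1%N) b d + G 1%N (f 0%N) b d.
  by rewrite (coef1_linear _ _ (Gt1 _ _)) !GtE /= G0.
have GtE2 a f d :
    fps_coef (Gt (c a) (FPS f) (c d)) 1 = dbr a (f 1%N) d + G 1%N a (f 0%N) d.
  by rewrite (coef1_linear _ _ (Gt2 _ _)) !GtE /= G0.
have GtE3 a b f :
    fps_coef (Gt (c a) (c b) (FPS f)) 1 = dbr a b (f 1%N) + G 1%N a b (f 0%N).
  by rewrite (coef1_linear _ _ (Gt3 _ _)) !GtE /= G0.
(* [innerE] has to be used first: it gives the inner values the form [FPS f] that [outerE] expects.
   [coef0E] then identifies the terms of index 0 with the operations of [A]. *)
pose outerE := (mutEl, mutEr, FtE1, FtE2, FtE3, GtE1, GtE2, GtE3).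
pose innerE := (mutE, FtE, GtE).
pose coef0E := (mu0, F0, G0).
have coef1 x y : x = y -> fps_coef x 1 = fps_coef y 1 by move->.
split=> //.
- move=> x y z; move/coef1: (ay1 ayt (c x) (c y) (c z)).
  (* The 0 of the goal is replaced by the coefficient of [t] in the associator identity; only the
     sign in front of a sum remains to be distributed. *)
  rewrite !innerE /= !outerE !coef0E => <-.
  by rewrite opprD !addrA.
- by move=> x y z w; move/coef1: (ay2 ayt (c x) (c y) (c z) (c w));
    rewrite !innerE !outerE !coef0E.
(* For an outer product, [mutEl] and [mutEr] put the [mul] term first, whereas this cocycle identity
   puts the [mu 1] term first, hence the commutation. *)
- by move=> x y z w; move/coef1: (ay3 ayt (c x) (c y) (c z) (c w));
    rewrite !innerE !outerE !coef0E [RHS in _ -> _ = RHS]addrC.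
- by move=> x y z w; move/coef1: (ay4 ayt (c x) (c y) (c z) (c w));
    rewrite !innerE !outerE !coef0E [RHS in _ -> _ = RHS]addrC.
- by move=> x y z w; move/coef1: (ay5 ayt (c x) (c y) (c z) (c w));
    rewrite !innerE !outerE !coef0E.
- move=> x y z w; move/coef1: (ay6 ayt (c x) (c y) (c z) (c w)).
  by rewrite !innerE !outerE !coef0E addrC => ->; rewrite addrC.
- move=> x y z w v.
  have [/coef1 + /coef1] := ay7 ayt (c x) (c y) (c z) (c w) (c v).
  by rewrite !innerE !outerE !coef0E.
- by move=> x y z w v; move/coef1: (ay8 ayt (c x) (c y) (c z) (c w) (c v));
    rewrite !innerE !outerE !coef0E.
- move=> x y z w v.
  have [/coef1 + /coef1] := ay9 ayt (c x) (c y) (c z) (c w) (c v).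
  by rewrite !innerE !outerE !coef0E.
- by move=> x y z w v; move/coef1: (ay10 ayt (c x) (c y) (c z) (c w) (c v));
    rewrite !innerE !outerE !coef0E.
- by move=> x y z w v; move/coef1: (ay11 ayt (c x) (c y) (c z) (c w) (c v));
    rewrite !innerE !outerE !coef0E.
Qed.
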